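(* For a monoid $(B,\mu,\eta)$ in a Cauchy complete braided monoidal category $(\mathcal M,\otimes,K,c)$, there is a bijection between (1) weak bimonoids of the form $(B,\mu,\eta,\delta,\varepsilon)$ in $\mathcal M$ (that is, choices of $(\delta,\varepsilon)$ making the given monoid a weak bimonoid); (2) weak bimonads $(\bullet\otimes B,\bullet\otimes\mu,\bullet\otimes\eta,\tau,\tau_0)$ on $\mathcal M$ (that is, choices of $(\tau,\tau_0)$) for which $$\tau_{X,Y}=(X\otimes c_{Y,B}\otimes B)\circ(X\otimes Y\otimes\tau_{K,K}):\ X\otimes Y\otimes B\to X\otimes B\otimes Y\otimes B$$ for all objects $X,Y$ of $\mathcal M$.
   Context: Monoidal categories need not be strict, but coherence isomorphisms are suppressed. An object also denotes its identity morphism. Cauchy complete means that idempotent morphisms split. $B^n$ denotes $B^{\otimes n}$. A weak bimonad on a Cauchy complete monoidal category $(\mathcal M,\otimes,K)$ is a monad $(T,m,u)$ with an opmonoidal structure $\tau_{X,Y}:T(X\otimes Y)\to TX\otimes TY$, $\tau_0:TK\to K$ on the functor $T$ (coassociative and counital) such that for all $X,Y,Z$: (W1) $m_X\circ T(TX\otimes\tau_0)\circ T(TX\otimes m_K)\circ T\tau_{X,TK}\circ Tu_{X\otimes TK}=(TX\otimes\tau_0)\circ(TX\otimes m_K)\circ\tau_{X,TK}$; (W2) $m_X\circ T(\tau_0\otimes TX)\circ T(m_K\otimes TX)\circ T\tau_{TK,X}\circ Tu_{TK\otimes X}=(\tau_0\otimes TX)\circ(m_K\otimes TX)\circ\tau_{TK,X}$;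 (W3) $(TX\otimes m_Y\otimes TZ)\circ(\tau_{X,TY}\otimes TZ)\circ(u_{X\otimes TY}\otimes TZ)\circ(X\otimes\tau_{Y,Z})\circ(X\otimes u_{Y\otimes Z})=(\tau_{X,Y}\otimes TZ)\circ\tau_{X\otimes Y,Z}\circ u_{X\otimes Y\otimes Z}$; (W4) $(TX\otimes m_Y\otimes TZ)\circ(TX\otimes\tau_{TY,Z})\circ(TX\otimes u_{TY\otimes Z})\circ(\tau_{X,Y}\otimes Z)\circ(u_{X\otimes Y}\otimes Z)=(\tau_{X,Y}\otimes TZ)\circ\tau_{X\otimes Y,Z}\circ u_{X\otimes Y\otimes Z}$; (W5) $(m_X\otimes m_Y)\circ\tau_{TX,TY}\circ T\tau_{X,Y}=\tau_{X,Y}\circ m_{X\otimes Y}$. (Equivalently: $\mathcal M^T$ carries a monoidal structure and the forgetful functor $\mathcal M^T\to\mathcal M$ a separable Frobenius structure.) A weak bimonoid in a braided monoidal category is an object $B$ with a monoid structure $(\mu,\eta)$ and a comonoid structure $(\delta,\varepsilon)$ such that (b) $\delta\circ\mu=(\mu\otimes\mu)\circ(B\otimes c_{B,B}\otimes B)\circ(\delta\otimes\delta)$; (v) $\varepsilon\circ\mu^2=(\varepsilon\otimes\varepsilon)(\mu\otimes\mu)(B\otimes\delta\otimes B)=(\varepsilon\otimes\varepsilon)(\mu\otimes\mu)(B\otimes c^{-1}_{B,B}\otimes B)(B\otimes\delta\otimes B)$, as morphisms $B^3\to K$, where $\mu^2:B^3\to B$ is the iterated multiplication; (w) $(\delta\otimes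 B)\circ\delta\circ\eta=(B\otimes\mu\otimes B)(\delta\otimes\delta)(\eta\otimes\eta)=(B\otimes\mu\otimes B)(B\otimes c^{-1}_{B,B}\otimes B)(\delta\otimes\delta)(\eta\otimes\eta)$, as morphisms $K\to B^3$. *)

(* Defs.v *)
From mathcomp Require Import ssreflect ssrfun.

Set Implicit Arguments.
Unset Strict Implicit.
Unset Printing Implicit Defensive.

Declare Scope cat_scope.
Delimit Scope cat_scope with cat.
Local Open Scope cat_scope.

Reserved Notation "X ~> Y" (at level 70, no associativity).
Reserved Notation "g ∘ f" (at level 40, left associativity).
Reserved Notation "X ⊗ Y" (at level 38, left associativity).
Reserved Notation "f ⊠ g" (at level 38, left associativity).
Reserved Notation "X ◁ f" (at level 38, left associativity).
Reserved Notation "f ▷ X" (at level 38, left associativity).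

Record category := Category {
  ob :> Type;
  hom : ob -> ob -> Type;
  idm : forall X, hom X X;
  compm : forall X Y Z, hom Y Z -> hom X Y -> hom X Z;
  comp_idl : forall X Y (f : hom X Y), compm (idm Y) f = f;
  comp_idr : forall X Y (f : hom X Y), compm f (idm X) = f;
  compA : forall X Y Z W (h : hom Z W) (g : hom Y Z) (f : hom X Y),
    compm h (compm g f) = compm (compm h g) f
}.

Notation "X ~> Y" := (hom X Y) : cat_scope.
Notation "g ∘ f" := (compm g f) : cat_scope.
Arguments idm {c} X.

Definition cauchy_complete (C : category) : Prop :=
  forall (X : C) (e : X ~> X), e ∘ e = e ->
    exists (Y : C) (p : X ~> Y) (i : Y ~> X), p ∘ i = idm Y /\ i ∘ p = e.

Record monoidal_category := MonoidalCategory {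
  mcat :> category;
  tens : mcat -> mcat -> mcat;
  tensm : forall X X' Y Y' : mcat,
    X ~> X' -> Y ~> Y' -> tens X Y ~> tens X' Y';
  munit : mcat;
  tensm_id : forall X Y : mcat, tensm (idm X) (idm Y) = idm (tens X Y);
  tensm_comp : forall (X X' X'' Y Y' Y'' : mcat)
    (f' : X' ~> X'') (f : X ~> X') (g' : Y' ~> Y'') (g : Y ~> Y'),
    tensm (f' ∘ f) (g' ∘ g) = tensm f' g' ∘ tensm f g;
  assoc : forall X Y Z : mcat, tens (tens X Y) Z ~> tens X (tens Y Z);
  associ : forall X Y Z : mcat, tens X (tens Y Z) ~> tens (tens X Y) Z;
  lunit : forall X : mcat, tens munit X ~> X;
  luniti : forall X : mcat, X ~> tens munit X;
  runit : forall X : mcat, tens X munit ~> X;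
  runiti : forall X : mcat, X ~> tens X munit;
  assocK : forall X Y Z : mcat, associ X Y Z ∘ assoc X Y Z = idm _;
  associK : forall X Y Z : mcat, assoc X Y Z ∘ associ X Y Z = idm _;
  lunitK : forall X : mcat, luniti X ∘ lunit X = idm _;
  lunitiK : forall X : mcat, lunit X ∘ luniti X = idm _;
  runitK : forall X : mcat, runiti X ∘ runit X = idm _;
  runitiK : forall X : mcat, runit X ∘ runiti X = idm _;
  assoc_nat : forall (X X' Y Y' Z Z' : mcat)
    (f : X ~> X') (g : Y ~> Y') (h : Z ~> Z'),
    assoc X' Y' Z' ∘ tensm (tensm f g) h = tensm f (tensm g h) ∘ assoc X Y Z;
  lunit_nat : forall (X Y : mcat) (f : X ~> Y),
    lunit Y ∘ tensm (idm munit) f = f ∘ lunit X;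
  runit_nat : forall (X Y : mcat) (f : X ~> Y),
    runit Y ∘ tensm f (idm munit) = f ∘ runit X;
  pentagon : forall W X Y Z : mcat,
    tensm (idm W) (assoc X Y Z) ∘ assoc W (tens X Y) Z
      ∘ tensm (assoc W X Y) (idm Z)
    = assoc W X (tens Y Z) ∘ assoc (tens W X) Y Z;
  triangle : forall X Y : mcat,
    tensm (idm X) (lunit Y) ∘ assoc X munit Y = tensm (runit X) (idm Y)
}.

Notation "X ⊗ Y" := (tens X Y) : cat_scope.
Notation "f ⊠ g" := (tensm f g) : cat_scope.
Notation "X ◁ f" := (tensm (idm X) f) : cat_scope.
Notation "f ▷ X" := (tensm f (idm X)) : cat_scope.
Arguments munit {m}.
Arguments assoc {m} X Y Z.
Arguments associ {m} X Y Z.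
Arguments lunit {m} X.
Arguments luniti {m} X.
Arguments runit {m} X.
Arguments runiti {m} X.

Record braided_category := BraidedCategory {
  bmcat :> monoidal_category;
  braid : forall X Y : bmcat, X ⊗ Y ~> Y ⊗ X;
  braidi : forall X Y : bmcat, Y ⊗ X ~> X ⊗ Y;
  braidK : forall X Y : bmcat, braidi X Y ∘ braid X Y = idm _;
  braidiK : forall X Y : bmcat, braid X Y ∘ braidi X Y = idm _;
  braid_nat : forall (X X' Y Y' : bmcat) (f : X ~> X') (g : Y ~> Y'),
    braid X' Y' ∘ (f ⊠ g) = (g ⊠ f) ∘ braid X Y;
  hexagon1 : forall X Y Z : bmcat,
    assoc Y Z X ∘ braid X (Y ⊗ Z) ∘ assoc X Y Z
    = (Y ◁ braid X Z) ∘ assoc Y X Z ∘ (braid X Y ▷ Z);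
  hexagon2 : forall X Y Z : bmcat,
    associ Z X Y ∘ braid (X ⊗ Y) Z ∘ associ X Y Z
    = (braid X Z ▷ Y) ∘ associ X Z Y ∘ (X ◁ braid Y Z)
}.

Arguments braid {b} X Y.
(* [braidi X Y] is the inverse of [braid X Y]; its domain is [Y ⊗ X]. *)
Arguments braidi {b} X Y.

Section Rebracketing.
Variable M : monoidal_category.

Definition rebr (A C D E : M) : (A ⊗ (C ⊗ D)) ⊗ E ~> (A ⊗ C) ⊗ (D ⊗ E) :=
  assoc (A ⊗ C) D E ∘ (associ A C D ▷ E).

Definition rebri (A C D E : M) : (A ⊗ C) ⊗ (D ⊗ E) ~> (A ⊗ (C ⊗ D)) ⊗ E :=
  (assoc A C D ▷ E) ∘ associ (A ⊗ C) D E.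

(* The morphism written A ⊗ g ⊗ E when associators are suppressed, with domain
   and codomain bracketed as products of two pairs. *)
Definition mid (A E C D C' D' : M) (g : C ⊗ D ~> C' ⊗ D') :
    (A ⊗ C) ⊗ (D ⊗ E) ~> (A ⊗ C') ⊗ (D' ⊗ E) :=
  rebr A C' D' E ∘ ((A ◁ g) ▷ E) ∘ rebri A C D E.

End Rebracketing.

Arguments rebr {M} A C D E.
Arguments rebri {M} A C D E.
Arguments mid {M} A E {C D C' D'} g.

Record monoid (M : monoidal_category) := Monoid {
  mon_ob :> M;
  mul : mon_ob ⊗ mon_ob ~> mon_ob;
  unt : munit ~> mon_ob;
  mulA : mul ∘ (mul ▷ mon_ob) = mul ∘ (mon_ob ◁ mul) ∘ assoc _ _ _;
  mul_untl : mul ∘ (unt ▷ mon_ob) = lunit mon_ob;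
  mul_untr : mul ∘ (mon_ob ◁ unt) = runit mon_ob
}.

Arguments mul {M} B : rename.
Arguments unt {M} B : rename.

Record is_comonoid (M : monoidal_category) (B : M)
    (delta : B ~> B ⊗ B) (eps : B ~> munit) : Prop := IsComonoid {
  comulA : assoc B B B ∘ (delta ▷ B) ∘ delta = (B ◁ delta) ∘ delta;
  comul_counl : lunit B ∘ (eps ▷ B) ∘ delta = idm B;
  comul_counr : runit B ∘ (B ◁ eps) ∘ delta = idm B
}.

Record weak_bimonoid (M : braided_category) (B : monoid M) := WeakBimonoid {
  comul : B ~> B ⊗ B;
  coun : B ~> munit;
  wbm_comonoid : is_comonoid comul coun;
  wbm_b : comul ∘ mul B
    = (mul B ⊠ mul B) ∘ mid B B (braid B B) ∘ (comul ⊠ comul);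
  wbm_v1 : coun ∘ mul B ∘ (mul B ▷ B)
    = lunit munit ∘ (coun ⊠ coun) ∘ (mul B ⊠ mul B) ∘ rebr B B B B
        ∘ ((B ◁ comul) ▷ B);
  wbm_v2 : coun ∘ mul B ∘ (mul B ▷ B)
    = lunit munit ∘ (coun ⊠ coun) ∘ (mul B ⊠ mul B)
        ∘ mid B B (braidi B B) ∘ rebr B B B B ∘ ((B ◁ comul) ▷ B);
  wbm_w1 : (comul ▷ B) ∘ comul ∘ unt B
    = ((B ◁ mul B) ▷ B) ∘ rebri B B B B ∘ (comul ⊠ comul)
        ∘ (unt B ⊠ unt B) ∘ luniti munit;
  wbm_w2 : (comul ▷ B) ∘ comul ∘ unt B
    = ((B ◁ mul B) ▷ B) ∘ rebri B B B B ∘ mid B B (braidi B B)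
        ∘ (comul ⊠ comul) ∘ (unt B ⊠ unt B) ∘ luniti munit
}.

Record endofunctor (C : category) := Endofunctor {
  fob :> C -> C;
  fmor : forall X Y : C, X ~> Y -> fob X ~> fob Y;
  fmor_id : forall X : C, fmor (idm X) = idm (fob X);
  fmor_comp : forall (X Y Z : C) (g : Y ~> Z) (f : X ~> Y),
    fmor (g ∘ f) = fmor g ∘ fmor f
}.

Arguments fmor {C} T {X Y} f : rename.

Record monad (C : category) := Monad {
  mfun :> endofunctor C;
  mm : forall X : C, mfun (mfun X) ~> mfun X;
  mu : forall X : C, X ~> mfun X;
  mm_nat : forall (X Y : C) (f : X ~> Y),
    mm Y ∘ fmor mfun (fmor mfun f) = fmor mfun f ∘ mm X;
  mu_nat : forall (X Y : C) (f : X ~> Y), mu Y ∘ f = fmor mfun f ∘ mu X;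
  mmA : forall X : C, mm X ∘ fmor mfun (mm X) = mm X ∘ mm (mfun X);
  mm_mul : forall X : C, mm X ∘ mu (mfun X) = idm (mfun X);
  mm_mur : forall X : C, mm X ∘ fmor mfun (mu X) = idm (mfun X)
}.

Arguments mm {C} T X : rename.
Arguments mu {C} T X : rename.

Record is_opmonoidal (M : monoidal_category) (T : endofunctor M)
    (tau : forall X Y : M, T (X ⊗ Y) ~> T X ⊗ T Y)
    (tau0 : T munit ~> munit) : Prop := IsOpmonoidal {
  opm_nat : forall (X X' Y Y' : M) (f : X ~> X') (g : Y ~> Y'),
    tau X' Y' ∘ fmor T (f ⊠ g) = (fmor T f ⊠ fmor T g) ∘ tau X Y;
  opm_coassoc : forall X Y Z : M,
    assoc (T X) (T Y) (T Z) ∘ (tau X Y ▷ T Z) ∘ tau (X ⊗ Y) Z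
    = (T X ◁ tau Y Z) ∘ tau X (Y ⊗ Z) ∘ fmor T (assoc X Y Z);
  opm_counl : forall X : M,
    lunit (T X) ∘ (tau0 ▷ T X) ∘ tau munit X = fmor T (lunit X);
  opm_counr : forall X : M,
    runit (T X) ∘ (T X ◁ tau0) ∘ tau X munit = fmor T (runit X)
}.

Record weak_bimonad (M : monoidal_category) (T : monad M) := WeakBimonad {
  tau : forall X Y : M, T (X ⊗ Y) ~> T X ⊗ T Y;
  tau0 : T munit ~> munit;
  wbd_opmonoidal : is_opmonoidal tau tau0;
  wbd_1 : forall X : M,
    mm T X ∘ fmor T (runit (T X)) ∘ fmor T (T X ◁ tau0)
      ∘ fmor T (T X ◁ mm T munit) ∘ fmor T (tau X (T munit))
      ∘ fmor T (mu T (X ⊗ T munit))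
    = runit (T X) ∘ (T X ◁ tau0) ∘ (T X ◁ mm T munit) ∘ tau X (T munit);
  wbd_2 : forall X : M,
    mm T X ∘ fmor T (lunit (T X)) ∘ fmor T (tau0 ▷ T X)
      ∘ fmor T (mm T munit ▷ T X) ∘ fmor T (tau (T munit) X)
      ∘ fmor T (mu T (T munit ⊗ X))
    = lunit (T X) ∘ (tau0 ▷ T X) ∘ (mm T munit ▷ T X) ∘ tau (T munit) X;
  wbd_3 : forall X Y Z : M,
    ((T X ◁ mm T Y) ▷ T Z) ∘ (tau X (T Y) ▷ T Z) ∘ (mu T (X ⊗ T Y) ▷ T Z)
      ∘ associ X (T Y) (T Z) ∘ (X ◁ tau Y Z) ∘ (X ◁ mu T (Y ⊗ Z))
      ∘ assoc X Y Z
    = (tau X Y ▷ T Z) ∘ tau (X ⊗ Y) Z ∘ mu T ((X ⊗ Y) ⊗ Z);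
  wbd_4 : forall X Y Z : M,
    associ (T X) (T Y) (T Z) ∘ (T X ◁ (mm T Y ▷ T Z))
      ∘ (T X ◁ tau (T Y) Z) ∘ (T X ◁ mu T (T Y ⊗ Z))
      ∘ assoc (T X) (T Y) Z ∘ (tau X Y ▷ Z) ∘ (mu T (X ⊗ Y) ▷ Z)
    = (tau X Y ▷ T Z) ∘ tau (X ⊗ Y) Z ∘ mu T ((X ⊗ Y) ⊗ Z);
  wbd_5 : forall X Y : M,
    (mm T X ⊠ mm T Y) ∘ tau (T X) (T Y) ∘ fmor T (tau X Y)
    = tau X Y ∘ mm T (X ⊗ Y)
}.

Section TensorMonad.
Variable M : monoidal_category.

Lemma whl_comp (W X Y Z : M) (g : Y ~> Z) (f : X ~> Y) :
  W ◁ (g ∘ f) = (W ◁ g) ∘ (W ◁ f).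
Proof. by rewrite -tensm_comp comp_idl. Qed.

Lemma whr_comp (W X Y Z : M) (g : Y ~> Z) (f : X ~> Y) :
  (g ∘ f) ▷ W = (g ▷ W) ∘ (f ▷ W).
Proof. by rewrite -tensm_comp comp_idl. Qed.

Lemma interchange (X X' Y Y' : M) (f : X ~> X') (g : Y ~> Y') :
  (X' ◁ g) ∘ (f ▷ Y) = (f ▷ Y') ∘ (X ◁ g).
Proof. by rewrite -!tensm_comp !comp_idl !comp_idr. Qed.

Lemma assoc_inj (W X Y Z : M) (f g : W ~> (X ⊗ Y) ⊗ Z) :
  assoc X Y Z ∘ f = assoc X Y Z ∘ g -> f = g.
Proof.
by move=> e; rewrite -(comp_idl f) -(comp_idl g) -assocK -!compA e.
Qed.

Lemma runit_inj (X Y : M) (f g : X ~> Y) :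
  f ▷ munit = g ▷ munit -> f = g.
Proof.
move=> e; rewrite -(comp_idr f) -(comp_idr g) -(runitiK X) !compA.
by rewrite -!runit_nat e.
Qed.

Lemma runit_tens (X Y : M) :
  runit (X ⊗ Y) = (X ◁ runit Y) ∘ assoc X Y munit.
Proof.
apply: runit_inj; apply: assoc_inj.
rewrite whr_comp compA assoc_nat.
rewrite -(triangle Y munit) whl_comp -!compA (compA _ _ (assoc X Y munit ▷ _)).
rewrite pentagon -(triangle (X ⊗ Y) munit) !compA -assoc_nat.
by rewrite tensm_id.
Qed.

Lemma runiti_nat (X Y : M) (f : X ~> Y) :
  runiti Y ∘ f = (f ▷ munit) ∘ runiti X.
Proof.
rewrite -(comp_idl (_ ▷ _)) -runitK -(compA (runiti Y)) runit_nat.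
by rewrite -!compA runitiK comp_idr.
Qed.

Variable B : monoid M.

Lemma rtens_fmor_id (X : M) : idm X ▷ B = idm (X ⊗ B).
Proof. exact: tensm_id. Qed.

Lemma rtens_fmor_comp (X Y Z : M) (g : Y ~> Z) (f : X ~> Y) :
  (g ∘ f) ▷ B = (g ▷ B) ∘ (f ▷ B).
Proof. exact: whr_comp. Qed.

Definition rtens_functor : endofunctor M :=
  Endofunctor rtens_fmor_id rtens_fmor_comp.

Definition rtens_mm (X : M) : (X ⊗ B) ⊗ B ~> X ⊗ B :=
  (X ◁ mul B) ∘ assoc X B B.

Definition rtens_mu (X : M) : X ~> X ⊗ B := (X ◁ unt B) ∘ runiti X.

Lemma rtens_mm_nat (X Y : M) (f : X ~> Y) :
  rtens_mm Y ∘ ((f ▷ B) ▷ B) = (f ▷ B) ∘ rtens_mm X.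
Proof.
by rewrite /rtens_mm -compA assoc_nat tensm_id !compA interchange.
Qed.

Lemma rtens_mu_nat (X Y : M) (f : X ~> Y) :
  rtens_mu Y ∘ f = (f ▷ B) ∘ rtens_mu X.
Proof. by rewrite /rtens_mu -compA runiti_nat !compA interchange. Qed.

Lemma rtens_mmA (X : M) :
  rtens_mm X ∘ (rtens_mm X ▷ B) = rtens_mm X ∘ rtens_mm (X ⊗ B).
Proof.
rewrite /rtens_mm whr_comp -!compA (compA (assoc X B B)) assoc_nat.
rewrite !compA -whl_comp mulA !whl_comp.
rewrite -(compA _ (X ◁ assoc B B B)) -(compA _ _ (assoc X B B ▷ B)) pentagon.
rewrite -(tensm_id X B) -!compA; congr (_ ∘ _).
by rewrite !compA assoc_nat.
Qed.

Lemma rtens_mm_mul (X : M) : rtens_mm X ∘ rtens_mu (X ⊗ B) = idm (X ⊗ B).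
Proof.
rewrite /rtens_mm /rtens_mu -(tensm_id X B) -!compA (compA (assoc X B B)).
rewrite assoc_nat !compA -whl_comp mul_untr -runit_tens runitiK.
by rewrite tensm_id.
Qed.

Lemma rtens_mm_mur (X : M) : rtens_mm X ∘ (rtens_mu X ▷ B) = idm (X ⊗ B).
Proof.
rewrite /rtens_mm /rtens_mu whr_comp -!compA (compA (assoc X B B)) assoc_nat.
rewrite !compA -whl_comp mul_untl triangle -whr_comp runitiK.
exact: tensm_id.
Qed.

Definition rtens_monad : monad M :=
  @Monad M rtens_functor rtens_mm rtens_mu rtens_mm_nat rtens_mu_nat
    rtens_mmA rtens_mm_mul rtens_mm_mur.

End TensorMonad.

(* τ_{K,K} read as a morphism B → B ⊗ B through the isomorphisms
   B ≅ (K ⊗ K) ⊗ B and K ⊗ B ≅ B. *)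
Definition tauKK (M : monoidal_category) (B : monoid M)
    (S : weak_bimonad (rtens_monad B)) : B ~> B ⊗ B :=
  (lunit B ⊠ lunit B) ∘ tau S munit munit ∘ (luniti munit ▷ B) ∘ luniti B.

Definition tau_from_tauKK (M : braided_category) (B : monoid M)
    (S : weak_bimonad (rtens_monad B)) : Prop :=
  forall X Y : M,
    tau S X Y = mid X B (braid Y B) ∘ ((X ⊗ Y) ◁ tauKK S).

(* Main.v *)
From Stdlib Require Import ProofIrrelevance FunctionalExtensionality.
From mathcomp Require Import ssreflect ssrfun ssrbool.
Require Import Defs.

(* Coherence is handled by replacing an object X by the functor X ⊗ -: then
   tensor products become composites of functors, and an equation between
   morphisms of M is equivalent to an equation between natural families without
   associators and unitors.

   In this strict setting (τ, τ0) is determined by δ = τ_{K,K} and ε = τ0, and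
   by naturality of the braiding each weak bimonad axiom for (τ, τ0) reduces to
   its instance at the unit object.  Then (W5) is (b), (W3) and (W4) are the two
   halves of (w), and, writing φ = ε μ, (W2) reads
     φ(a ⊗ 1_1) 1_2 b = φ(a ⊗ b_1) b_2,
   where δ(b) = b_1 ⊗ b_2.  It gives the first half of (v) by
     ε(abc) = φ(a ⊗ (bc)_1) ε((bc)_2) = φ(a ⊗ 1_1) ε(1_2 bc)
            = φ(a ⊗ b_1) φ(b_2 ⊗ c),
   and conversely
     φ(a ⊗ b_1) b_2 = ε(a 1_1 b_1) 1_2 b_2 = φ(a ⊗ 1_1) φ(1_2 ⊗ b_1) 1_3 b_2
                    = φ(a ⊗ 1_1) ε((1_2 b)_1) (1_2 b)_2 = φ(a ⊗ 1_1) 1_2 b.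
   (W1) and the second half of (v) are the same statements for the coopposite
   comultiplication c^{-1} δ and the reverse braiding. *)

Set Implicit Arguments.
Unset Strict Implicit.
Unset Printing Implicit Defensive.

Local Open Scope cat_scope.

(** * Strictification *)

Section Strictification.
Variable M : monoidal_category.

Lemma lunit_inj (X Y : M) (f g : X ~> Y) :
  munit ◁ f = munit ◁ g -> f = g.
Proof.
move=> e; rewrite -(comp_idr f) -(comp_idr g) -(lunitiK X) !compA.
by rewrite -!lunit_nat e.
Qed.

Lemma comp_assoc_inj (W X Y Z : M) (f g : X ⊗ (Y ⊗ Z) ~> W) :
  f ∘ assoc X Y Z = g ∘ assoc X Y Z -> f = g.
Proof.
by move=> e; rewrite -(comp_idr f) -(comp_idr g) -associK !compA e.
Qed.

(** Kelly's argument: tensoring with the unit is faithful, and after precomposing with invertible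
    associators both sides are compared by the pentagon and the triangle. *)
Lemma lunit_tens (X Y : M) :
  lunit X ▷ Y = lunit (X ⊗ Y) ∘ assoc munit X Y.
Proof.
apply: lunit_inj; rewrite whl_comp.
apply: comp_assoc_inj; rewrite -assoc_nat.
have e : ((munit ◁ lunit X) ▷ Y) ∘ (assoc munit munit X ▷ Y)
    = (runit munit ▷ X) ▷ Y by rewrite -whr_comp triangle.
have E : (assoc munit X Y ∘ ((munit ◁ lunit X) ▷ Y)) ∘ (assoc munit munit X ▷ Y)
  = ((munit ◁ lunit (X ⊗ Y)) ∘ (munit ◁ assoc munit X Y)
       ∘ assoc munit (munit ⊗ X) Y) ∘ (assoc munit munit X ▷ Y).
  rewrite -compA e assoc_nat tensm_id -triangle.
  by rewrite -!compA -pentagon !compA.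
have inv : (assoc munit munit X ▷ Y) ∘ (associ munit munit X ▷ Y) = idm _.
  by rewrite -whr_comp associK tensm_id.
move/(congr1 (fun f => f ∘ (associ munit munit X ▷ Y))): E.
by rewrite -!compA inv !comp_idr.
Qed.

(** Brackets can be forgotten only by recursion on syntax, so objects are reified first. *)
Inductive oexpr : Type :=
| OAtom of M
| OUnit
| OTens of oexpr & oexpr.

Fixpoint oev (a : oexpr) : M :=
  match a with
  | OAtom X => X
  | OUnit => munit
  | OTens a b => oev a ⊗ oev b
  end.

(* The functor oev a ⊗ -, strictified: composites of these functors are
   associative and unital by computation. *)
Fixpoint str (a : oexpr) (W : M) : M :=
  match a with
  | OAtom X => X ⊗ W
  | OUnit => W
  | OTens a b => str a (str b W)
  end.

Fixpoint strm (a : oexpr) (W W' : M) (g : W ~> W') : str a W ~> str a W' :=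
  match a with
  | OAtom X => X ◁ g
  | OUnit => g
  | OTens a b => strm a (strm b g)
  end.

Fixpoint flat (a : oexpr) (W : M) : oev a ⊗ W ~> str a W :=
  match a with
  | OAtom X => idm _
  | OUnit => lunit W
  | OTens a b => flat a (str b W) ∘ (oev a ◁ flat b W) ∘ assoc _ _ W
  end.

Fixpoint flati (a : oexpr) (W : M) : str a W ~> oev a ⊗ W :=
  match a with
  | OAtom X => idm _
  | OUnit => luniti W
  | OTens a b => associ _ _ W ∘ (oev a ◁ flati b W) ∘ flati a (str b W)
  end.

Lemma flatK a W : flati a W ∘ flat a W = idm _.
Proof.
elim: a W => [X|/=|a IHa b IHb] W /=; first by rewrite comp_idl.
  exact: lunitK.
rewrite -!compA (compA (flati a _)) IHa comp_idl (compA (_ ◁ _)) -whl_comp IHb.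
by rewrite tensm_id comp_idl assocK.
Qed.

Lemma flatiK a W : flat a W ∘ flati a W = idm _.
Proof.
elim: a W => [X|/=|a IHa b IHb] W /=; first by rewrite comp_idl.
  exact: lunitiK.
rewrite -!compA (compA (assoc _ _ _)) associK comp_idl (compA (_ ◁ _)).
by rewrite -whl_comp IHb tensm_id comp_idl IHa.
Qed.

Lemma strm_id a W : strm a (idm W) = idm _.
Proof. by elim: a W => [X|/=|a IHa b IHb] W //=; rewrite ?tensm_id ?IHb. Qed.

Lemma flat_nat a (W W' : M) (g : W ~> W') :
  flat a W' ∘ (oev a ◁ g) = strm a g ∘ flat a W.
Proof.
elim: a W W' g => [X|/=|a IHa b IHb] W W' g /=.
- by rewrite comp_idl comp_idr.
- exact: lunit_nat.
rewrite !compA -IHa -!compA -tensm_id assoc_nat; congr (_ ∘ _).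
by rewrite !compA -!whl_comp IHb.
Qed.

(** The component at [W] of the transformation induced by [f]; [locked] hides the composite from
    conversion. *)
Definition strict a b (f : oev a ~> oev b) (W : M) : str a W ~> str b W :=
  locked (flat b W ∘ (f ▷ W) ∘ flati a W).

Lemma strict_flat a b (f : oev a ~> oev b) W :
  strict f W ∘ flat a W = flat b W ∘ (f ▷ W).
Proof. by rewrite /strict -lock -compA flatK comp_idr. Qed.

Lemma strict_eq a b (f : oev a ~> oev b) W (g : str a W ~> str b W) :
  g ∘ flat a W = flat b W ∘ (f ▷ W) -> strict f W = g.
Proof. by move=> e; rewrite /strict -lock -e -compA flatiK comp_idr. Qed.

(** The component at the unit suffices, because tensoring with the unit is faithful. *)
Lemma strict_inj a b (f g : oev a ~> oev b) :
  strict f munit = strict g munit -> f = g.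
Proof.
move/(congr1 (fun h => flati b munit ∘ (h ∘ flat a munit))).
by rewrite !strict_flat !compA !flatK !comp_idl; apply: runit_inj.
Qed.

Lemma strict_nat a b (f : oev a ~> oev b) (W W' : M) (g : W ~> W') :
  strict f W' ∘ strm a g = strm b g ∘ strict f W.
Proof.
rewrite -(comp_idr (strm a g)) -(flatiK a) (compA (strm a g)) -flat_nat !compA.
rewrite strict_flat -(compA _ _ (_ ◁ _)) -interchange !compA.
by rewrite flat_nat /strict -lock !compA.
Qed.

Lemma strict_id a W : strict (idm (oev a)) W = idm _.
Proof. by apply: strict_eq; rewrite comp_idl tensm_id comp_idr. Qed.

Lemma strict_comp a b d (g : oev b ~> oev d) (f : oev a ~> oev b) W :
  strict (g ∘ f) W = strict g W ∘ strict f W.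
Proof.
apply: strict_eq.
by rewrite -compA strict_flat compA strict_flat whr_comp -compA.
Qed.

Lemma strict_tens a a' b b' (f : oev a ~> oev a') (g : oev b ~> oev b') W :
  @strict (OTens a b) (OTens a' b') (f ⊠ g) W
  = strict f (str b' W) ∘ strm a (strict g W).
Proof.
apply: (@strict_eq (OTens a b) (OTens a' b')) => /=.
rewrite -!compA assoc_nat !compA; congr (_ ∘ _).
rewrite -(compA _ (strm a _)) -flat_nat (compA (strict f _)) strict_flat.
rewrite -!compA; congr (_ ∘ _).
rewrite -!tensm_comp !comp_idl !comp_idr; congr (_ ⊠ _).
exact: strict_flat.
Qed.

(** The pentagon together with naturality of the associator; for the unitors below the reasons are
    [lunit_tens] and [triangle]. *)
Lemma strict_assoc a b d W :
  @strict (OTens (OTens a b) d) (OTens a (OTens b d)) (assoc _ _ _) W = idm _.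
Proof.
apply: (@strict_eq (OTens (OTens a b) d) (OTens a (OTens b d))) => /=.
rewrite comp_idl !whl_comp -!compA (compA (_ ◁ assoc _ _ _)) pentagon.
rewrite -(tensm_id (oev a)).
rewrite !compA -(compA _ (oev a ◁ (oev b ◁ _)) (assoc _ _ _)) -assoc_nat.
by rewrite !compA.
Qed.

Lemma strict_lunit a W :
  @strict (OTens OUnit a) a (lunit _) W = idm _.
Proof.
apply: (@strict_eq (OTens OUnit a) a) => /=.
by rewrite comp_idl lunit_tens lunit_nat compA.
Qed.

Lemma strict_runit a W :
  @strict (OTens a OUnit) a (runit _) W = idm _.
Proof.
apply: (@strict_eq (OTens a OUnit) a) => /=.
by rewrite comp_idl -compA triangle.
Qed.

Lemma strict_associ a b d W :
  @strict (OTens a (OTens b d)) (OTens (OTens a b) d) (associ _ _ _) W = idm _.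
Proof.
apply: (@strict_eq (OTens a (OTens b d)) (OTens (OTens a b) d)).
have :=
  @strict_flat (OTens (OTens a b) d) (OTens a (OTens b d)) (assoc _ _ _) W.
rewrite strict_assoc !comp_idl => ->.
by rewrite -compA -whr_comp associK tensm_id comp_idr.
Qed.

Lemma strict_luniti a W :
  @strict a (OTens OUnit a) (luniti _) W = idm _.
Proof.
apply: (@strict_eq a (OTens OUnit a)).
have := @strict_flat (OTens OUnit a) a (lunit _) W.
rewrite strict_lunit !comp_idl => ->.
by rewrite -compA -whr_comp lunitiK tensm_id comp_idr.
Qed.

Lemma strict_runiti a W :
  @strict a (OTens a OUnit) (runiti _) W = idm _.
Proof.
apply: (@strict_eq a (OTens a OUnit)).
have := @strict_flat (OTens a OUnit) a (runit _) W.
rewrite strict_runit !comp_idl => ->.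
by rewrite -compA -whr_comp runitiK tensm_id comp_idr.
Qed.

(** [MBox] holds a morphism treated as opaque; the other constructors mark the structure that [mstr]
    interprets strictly. *)
Inductive mexpr : oexpr -> oexpr -> Type :=
| MBox a b of oev a ~> oev b : mexpr a b
| MId a : mexpr a a
| MComp a b d of mexpr b d & mexpr a b : mexpr a d
| MTens a a' b b' of mexpr a a' & mexpr b b' : mexpr (OTens a b) (OTens a' b')
| MAssoc a b d : mexpr (OTens (OTens a b) d) (OTens a (OTens b d))
| MAssoci a b d : mexpr (OTens a (OTens b d)) (OTens (OTens a b) d)
| MLunit a : mexpr (OTens OUnit a) a
| MLuniti a : mexpr a (OTens OUnit a)
| MRunit a : mexpr (OTens a OUnit) a
| MRuniti a : mexpr a (OTens a OUnit).

Fixpoint mev a b (f : mexpr a b) : oev a ~> oev b :=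
  match f with
  | MBox _ _ f => f
  | MId _ => idm _
  | MComp _ _ _ g f => mev g ∘ mev f
  | MTens _ _ _ _ f g => mev f ⊠ mev g
  | MAssoc _ _ _ => assoc _ _ _
  | MAssoci _ _ _ => associ _ _ _
  | MLunit _ => lunit _
  | MLuniti _ => luniti _
  | MRunit _ => runit _
  | MRuniti _ => runiti _
  end.

Fixpoint mstr a b (f : mexpr a b) (W : M) : str a W ~> str b W :=
  match f with
  | MBox _ _ f => strict f W
  | MId _ => idm _
  | MComp _ _ _ g f => mstr g W ∘ mstr f W
  | MTens a _ _ b' f g => mstr f (str b' W) ∘ strm a (mstr g W)
  | MAssoc _ _ _ => idm _
  | MAssoci _ _ _ => idm _
  | MLunit _ => idm _
  | MLuniti _ => idm _
  | MRunit _ => idm _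
  | MRuniti _ => idm _
  end.

Lemma mstrE a b (f : mexpr a b) W : strict (mev f) W = mstr f W.
Proof.
elim: f W => {a b} //=.
- by move=> a W; rewrite strict_id.
- by move=> a b d g IHg f IHf W; rewrite strict_comp IHf IHg.
- by move=> a a' b b' f IHf g IHg W; rewrite strict_tens IHf IHg.
- exact: strict_assoc.
- exact: strict_associ.
- exact: strict_lunit.
- exact: strict_luniti.
- exact: strict_runit.
- exact: strict_runiti.
Qed.

(** Reflection principle: [strict_goal] uses it from right to left, [strict_hyp] from left to
    right. *)
Lemma strictP a b (f g : mexpr a b) :
  mev f = mev g <-> (forall W, mstr f W = mstr g W).
Proof.
split=> [e W | e]; first by rewrite -!mstrE e.
by apply: strict_inj; rewrite !mstrE.
Qed.

End Strictification.

(** * Reflection tactics *)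

Ltac reify_ob X :=
  lazymatch X with
  | tens ?A ?B =>
    let a := reify_ob A in let b := reify_ob B in constr:(OTens a b)
  | @munit ?M => constr:(@OUnit M)
  | @oev _ ?a => a
  | fob (mfun (rtens_monad ?B)) ?X => reify_ob (tens X (mon_ob B))
  | _ => constr:(OAtom X)
  end.

Ltac reify_mor f :=
  lazymatch f with
  | compm ?g ?h =>
    let eg := reify_mor g in let eh := reify_mor h in constr:(MComp eg eh)
  | tensm ?g ?h =>
    let eg := reify_mor g in let eh := reify_mor h in constr:(MTens eg eh)
  | idm ?X => let a := reify_ob X in constr:(MId a)
  | assoc ?X ?Y ?Z =>
    let a := reify_ob X in let b := reify_ob Y in let d := reify_ob Z in
    constr:(MAssoc a b d)
  | associ ?X ?Y ?Z =>
    let a := reify_ob X in let b := reify_ob Y in let d := reify_ob Z in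
    constr:(MAssoci a b d)
  | lunit ?X => let a := reify_ob X in constr:(MLunit a)
  | luniti ?X => let a := reify_ob X in constr:(MLuniti a)
  | runit ?X => let a := reify_ob X in constr:(MRunit a)
  | runiti ?X => let a := reify_ob X in constr:(MRuniti a)
  | _ =>
    lazymatch type of f with
    | hom ?X ?Y =>
      let a := reify_ob X in let b := reify_ob Y in constr:(@MBox _ a b f)
    end
  end.

Ltac strict_norm :=
  rewrite ?whl_comp ?strm_id ?tensm_id ?comp_idl ?comp_idr -?compA.

Ltac strict_goal :=
  lazymatch goal with
  | |- ?l = ?r =>
    let e1 := reify_mor l in let e2 := reify_mor r in
    refine (proj2 (@strictP _ _ _ e1 e2) _)
  end;
  let W := fresh "W" in intro W; cbn [mstr strm str oev]; strict_norm.

Ltac strict_hyp H W :=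
  lazymatch type of H with
  | ?l = ?r =>
    let e1 := reify_mor l in let e2 := reify_mor r in
    apply (fun h => proj1 (@strictP _ _ _ e1 e2) h W) in H
  end;
  cbn [mstr strm str oev] in H;
  rewrite ?whl_comp ?strm_id ?tensm_id ?comp_idl ?comp_idr -?compA in H.

(** * Braidings in the strict setting *)

Section Braid.
Variable M : braided_category.
Implicit Types a b d : oexpr M.

Notation sbr a b :=
  (@strict M (OTens a b) (OTens b a) (braid (oev a) (oev b))).

(** The hexagon with its associators turned into identities, for expressions of any shape, including
    the unit. *)
Lemma sbr_tensr a b d W :
  sbr a (OTens b d) W = strm b (sbr a d W) ∘ sbr a b (str d W).
Proof.
have H := hexagon1 (oev a) (oev b) (oev d).
strict_hyp H W.
exact: H.
Qed.

Lemma sbr_tensl a b d W :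
  sbr (OTens a b) d W = sbr a d (str b W) ∘ strm a (sbr b d W).
Proof.
have H := hexagon2 (oev a) (oev b) (oev d).
strict_hyp H W.
exact: H.
Qed.

Notation sbri a b :=
  (@strict M (OTens b a) (OTens a b) (braidi (oev a) (oev b))).

Lemma sbrK a b W : sbri a b W ∘ sbr a b W = idm _.
Proof.
have H := braidK (oev a) (oev b).
strict_hyp H W.
exact: H.
Qed.

Lemma sbriK a b W : sbr a b W ∘ sbri a b W = idm _.
Proof.
have H := braidiK (oev a) (oev b).
strict_hyp H W.
exact: H.
Qed.

(** By naturality along [K ⊗ K ≅ K] and the hexagon this braiding is idempotent; being invertible,
    it is the identity. *)
Lemma sbr_unitl a W : sbr (OUnit M) a W = idm _.
Proof.
have H := braid_nat (lunit munit) (idm (oev a)); strict_hyp H W.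
have E : sbr (OUnit M) a W = sbr (OUnit M) a W ∘ sbr (OUnit M) a W.
  by rewrite -[RHS](sbr_tensl (OUnit M) (OUnit M) a W); apply: H.
move/(congr1 (fun f => sbri (OUnit M) a W ∘ f)): E.
by rewrite compA sbrK comp_idl => <-.
Qed.

Lemma sbr_unitr a W : sbr a (OUnit M) W = idm _.
Proof.
have H := braid_nat (idm (oev a)) (lunit munit); strict_hyp H W.
have E : sbr a (OUnit M) W = sbr a (OUnit M) W ∘ sbr a (OUnit M) W.
  by rewrite -[RHS](sbr_tensr a (OUnit M) (OUnit M) W); apply: H.
move/(congr1 (fun f => sbri a (OUnit M) W ∘ f)): E.
by rewrite compA sbrK comp_idl => <-.
Qed.

End Braid.

(* Composites are kept nested to the right; [chainN] rewrites an initial segment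
   of N factors of such a composite, and [whlN] whiskers the rule first. *)
Section Chain.
Variable M : monoidal_category.

Lemma compAr (X Y Z W : M) (h : Z ~> W) (g : Y ~> Z) (f : X ~> Y) :
  (h ∘ g) ∘ f = h ∘ (g ∘ f).
Proof. by rewrite compA. Qed.

Lemma chain2 (X Y Z : M) (f : Y ~> Z) (g : X ~> Y) h :
  f ∘ g = h -> forall W (k : W ~> X), f ∘ (g ∘ k) = h ∘ k.
Proof. by move=> <- *; rewrite !compA. Qed.

Lemma chain3 (X Y Z T : M) (f : Z ~> T) (g : Y ~> Z) (h : X ~> Y) l :
  f ∘ (g ∘ h) = l -> forall W (k : W ~> X), f ∘ (g ∘ (h ∘ k)) = l ∘ k.
Proof. by move=> <- *; rewrite !compA. Qed.

Lemma whl2 (V X Y Z : M) (f : Y ~> Z) (g : X ~> Y) h :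
  f ∘ g = h -> (V ◁ f) ∘ (V ◁ g) = V ◁ h.
Proof. by move=> <-; rewrite whl_comp. Qed.

Lemma whl3 (V X Y Z T : M) (f : Z ~> T) (g : Y ~> Z) (h : X ~> Y) l :
  f ∘ (g ∘ h) = l -> (V ◁ f) ∘ ((V ◁ g) ∘ (V ◁ h)) = V ◁ l.
Proof. by move=> <-; rewrite !whl_comp. Qed.

Definition chainE := (whl_comp, tensm_id, comp_idl, comp_idr, compAr).
End Chain.

(** The digits count the tensor factors of domain and codomain, zero standing for the unit. *)
Local Notation strict01 := (@strict _ (OUnit _) (OAtom _)).
Local Notation strict10 := (@strict _ (OAtom _) (OUnit _)).
Local Notation strict11 := (@strict _ (OAtom _) (OAtom _)).
Local Notation strict12 := (@strict _ (OAtom _) (OTens (OAtom _) (OAtom _))).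
Local Notation strict21 := (@strict _ (OTens (OAtom _) (OAtom _)) (OAtom _)).
Local Notation strict22 :=
  (@strict _ (OTens (OAtom _) (OAtom _)) (OTens (OAtom _) (OAtom _))).

(** * The interchange law as naturality in the parameter [W] *)

Section BoxNaturality.
Variables (M : monoidal_category) (U V X Y W W' : M) (g : W ~> W').

Lemma nat01 (f : munit ~> X) :
  strict01 f W' ∘ g = (X ◁ g) ∘ strict01 f W.
Proof. exact: (@strict_nat _ (OUnit _) (OAtom _)). Qed.

Lemma nat10 (f : X ~> munit) :
  strict10 f W' ∘ (X ◁ g) = g ∘ strict10 f W.
Proof. exact: (@strict_nat _ (OAtom _) (OUnit _)). Qed.

Lemma nat11 (f : X ~> Y) :
  strict11 f W' ∘ (X ◁ g) = (Y ◁ g) ∘ strict11 f W.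
Proof. exact: (@strict_nat _ (OAtom _) (OAtom _)). Qed.

Lemma nat12 (f : X ~> U ⊗ V) :
  strict12 f W' ∘ (X ◁ g) = (U ◁ (V ◁ g)) ∘ strict12 f W.
Proof. exact: (@strict_nat _ (OAtom _) (OTens (OAtom _) (OAtom _))). Qed.

Lemma nat21 (f : U ⊗ V ~> X) :
  strict21 f W' ∘ (U ◁ (V ◁ g)) = (X ◁ g) ∘ strict21 f W.
Proof. exact: (@strict_nat _ (OTens (OAtom _) (OAtom _)) (OAtom _)). Qed.

Lemma nat22 (f : U ⊗ V ~> X ⊗ Y) :
  strict22 f W' ∘ (U ◁ (V ◁ g)) = (X ◁ (Y ◁ g)) ∘ strict22 f W.
Proof.
exact: (@strict_nat _ (OTens (OAtom _) (OAtom _)) (OTens (OAtom _) (OAtom _))).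
Qed.

End BoxNaturality.

(** * The counit axioms and (W2) *)

Section Core.
Variables (M : monoidal_category) (B : M).
Variables (m : B ⊗ B ~> B) (e : munit ~> B) (d : B ~> B ⊗ B) (n : B ~> munit).
Variable c : B ⊗ B ~> B ⊗ B.

Notation sm := (strict21 m).
Notation se := (strict01 e).
Notation sd := (strict12 d).
Notation sn := (strict10 n).
Notation sc := (strict22 c).

Definition sassoc := forall W, sm W ∘ sm (B ⊗ W) = sm W ∘ (B ◁ sm W).
Definition sunitl := forall W, sm W ∘ se (B ⊗ W) = idm _.
Definition scoassoc := forall W, sd (B ⊗ W) ∘ sd W = (B ◁ sd W) ∘ sd W.
Definition scounitl := forall W, sn (B ⊗ W) ∘ sd W = idm _.

(** [c] is kept arbitrary, to be used both as the braiding with [δ] and as its inverse with the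
    coopposite comultiplication. *)
Definition sbimon := forall W,
  sd W ∘ sm W
  = sm (B ⊗ W) ∘ ((B ◁ (B ◁ sm W)) ∘ ((B ◁ sc (B ⊗ W))
      ∘ (sd (B ⊗ (B ⊗ W)) ∘ (B ◁ sd W)))).

Definition sweak_counit := forall W,
  sn W ∘ (sm W ∘ sm (B ⊗ W))
  = sn W ∘ ((B ◁ sn W) ∘ (sm (B ⊗ W) ∘ ((B ◁ (B ◁ sm W))
      ∘ (B ◁ sd (B ⊗ W))))).

Definition sbimonad2 := forall W,
  sm W ∘ (sn (B ⊗ (B ⊗ W)) ∘ (sm (B ⊗ (B ⊗ W)) ∘ ((B ◁ sd (B ⊗ W))
      ∘ (B ◁ se (B ⊗ W)))))
  = sn (B ⊗ W) ∘ (sm (B ⊗ W) ∘ (B ◁ sd W)).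

Lemma sbimonad2_of_weak_counit :
  sassoc -> sunitl -> scoassoc -> scounitl -> sbimon -> sweak_counit ->
  sbimonad2.
Proof.
move=> mA mul1 dA dul b v W.
(* [δ(b) = δ(1b)], expanded by the bimonoid axiom. *)
have bW : sd W = sm (B ⊗ W) ∘ ((B ◁ (B ◁ sm W)) ∘ ((B ◁ sc (B ⊗ W))
      ∘ (sd (B ⊗ (B ⊗ W)) ∘ ((B ◁ sd W) ∘ se (B ⊗ W))))).
  by rewrite -[LHS]comp_idr -mul1 compA b ?chainE.
have vW U : sn U ∘ (sm U ∘ (B ◁ sm U)) 
  = sn U ∘ (sn (B ⊗ U) ∘ (sm (B ⊗ U) ∘ ((B ◁ (B ◁ sm U))
      ∘ (B ◁ sd (B ⊗ U))))).
  by rewrite -mA v !compA nat10.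
(* [ab = ε((ab)_1) (ab)_2], expanded by the bimonoid axiom. *)
have mW : sm W = sn (B ⊗ W) ∘ (sm (B ⊗ W) ∘ ((B ◁ (B ◁ sm W))
      ∘ ((B ◁ sc (B ⊗ W)) ∘ (sd (B ⊗ (B ⊗ W)) ∘ (B ◁ sd W))))).
  by rewrite -b compA dul comp_idl.
(* The right side becomes [ε(a(1_1 b_1)) 1_2 b_2]; the counit axiom splits it, and coassociativity
   then rearranges the legs of [δ(1)]. *)
rewrite [sd W in RHS]bW ?chainE (chain3 (vW _)) ?chainE.
rewrite (chain2 (whl2 _ (nat12 _ _))) ?chainE.
rewrite /= (chain2 (whl2 _ (nat12 _ _))) ?chainE.
rewrite (chain2 (whl2 _ (dA _))) ?chainE (chain2 (whl2 _ (nat12 _ _))) ?chainE.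
rewrite (chain2 (esym (nat10 (sm W) n))) ?chainE (chain2 (esym (nat21 _ m))).
(* On the left the product [1_2 b] is expanded, which gives the same expression. *)
rewrite [in LHS]mW.
rewrite ?chainE /= (chain2 (nat21 _ m)) ?chainE (chain2 (nat10 _ n)) ?chainE.
by [].
Qed.

Definition scounitr := forall W, (B ◁ sn W) ∘ sd W = idm _.

Lemma weak_counit_of_sbimonad2 :
  sassoc -> scounitr -> sbimonad2 -> sweak_counit.
Proof.
move=> mA dur w W.
(* [φ(a ⊗ b) = φ(a ⊗ 1_1) ε(1_2 b)], by applying [ε] to (W2) and using the counit law on [b]. *)
have nm U : sn U ∘ sm U = sn U ∘ (sm U ∘ (sn (B ⊗ (B ⊗ U))
    ∘ (sm (B ⊗ (B ⊗ U)) ∘ ((B ◁ sd (B ⊗ U)) ∘ (B ◁ se (B ⊗ U)))))).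
  rewrite w (chain2 (esym (nat10 _ n))) ?chainE (chain2 (esym (nat21 _ m))).
  by rewrite ?chainE -whl_comp dur tensm_id comp_idr.
rewrite (chain2 (nat10 _ n)) ?chainE (chain2 (nat21 _ m)) ?chainE.
(* (W2) read backwards turns the right side into [φ(a ⊗ 1_1) ε((1_2 b) c)]; on the left [nm] is
   applied to [a] and [bc]. *)
rewrite (chain2 (nat10 _ n)) ?chainE -(w (B ⊗ W)) mA (chain2 (nm W)) ?chainE.
rewrite (whl2 _ (nat01 _ e)) ?chainE (chain2 (whl2 _ (nat12 _ d))) ?chainE.
rewrite (chain2 (nat21 _ m)) ?chainE (chain2 (nat10 _ n)) ?chainE.
by rewrite (chain2 (mA _)) ?chainE.
Qed.

End Core.

(** * The reverse braiding *)

Section ReverseBraiding.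
Variable M : braided_category.

Lemma comp_inv_uniq (C : category) (X Y : C) (f : X ~> Y) (g h : Y ~> X) :
  g ∘ f = idm X -> f ∘ h = idm Y -> g = h.
Proof. by move=> gf fh; rewrite -[LHS]comp_idr -fh compA gf comp_idl. Qed.

(** Both sides are inverse to the composite in [hexagon2]: inverting the braiding interchanges the
    two hexagons. *)
Lemma rev_hexagon1 (X Y Z : M) :
  assoc Y Z X ∘ braidi (Y ⊗ Z) X ∘ assoc X Y Z
  = (Y ◁ braidi Z X) ∘ assoc Y X Z ∘ (braidi Y X ▷ Z).
Proof.
apply: (@comp_inv_uniq M _ _ (associ X Y Z ∘ braid (Y ⊗ Z) X ∘ associ Y Z X)).
  rewrite !chainE (chain2 (associK _ _ _)) comp_idl.
  by rewrite (chain2 (braidK _ _)) comp_idl associK.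
rewrite hexagon2 !chainE (chain2 (whl2 _ (braidiK _ _))) !chainE.
by rewrite (chain2 (assocK _ _ _)) !chainE -whr_comp braidiK tensm_id.
Qed.

Lemma rev_hexagon2 (X Y Z : M) :
  associ Z X Y ∘ braidi Z (X ⊗ Y) ∘ associ X Y Z
  = (braidi Z X ▷ Y) ∘ associ X Z Y ∘ (X ◁ braidi Z Y).
Proof.
apply: (@comp_inv_uniq M _ _ (assoc X Y Z ∘ braid Z (X ⊗ Y) ∘ assoc Z X Y)).
  rewrite !chainE (chain2 (assocK _ _ _)) comp_idl.
  by rewrite (chain2 (braidK _ _)) comp_idl assocK.
rewrite hexagon1 !chainE.
have H : (braid Z X ▷ Y) ∘ (braidi Z X ▷ Y) = idm _.
  by rewrite -whr_comp braidiK tensm_id.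
rewrite (chain2 H) comp_idl (chain2 (associK _ _ _)) comp_idl.
by rewrite -whl_comp braidiK tensm_id.
Qed.

Lemma rev_braid_nat (X X' Y Y' : M) (f : X ~> X') (g : Y ~> Y') :
  braidi Y' X' ∘ (f ⊠ g) = (g ⊠ f) ∘ braidi Y X.
Proof.
rewrite -[LHS]comp_idr -(braidiK Y X) !chainE (chain2 (esym (braid_nat _ _))).
by rewrite !chainE (chain2 (braidK _ _)) comp_idl.
Qed.

Definition rev_braided : braided_category :=
  @BraidedCategory M (fun X Y => braidi Y X) (fun X Y => braid Y X)
    (fun X Y => braidiK Y X) (fun X Y => braidK Y X) rev_braid_nat
    rev_hexagon1 rev_hexagon2.

End ReverseBraiding.

(** * Sliding morphisms through crossings *)

Section BraidNaturality.
Variables (M : braided_category) (V X Y Z : M).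

Notation c X Y := (strict22 (braid X Y)).

Lemma braid_mulr (f : Y ⊗ Z ~> V) W :
  c X V W ∘ (X ◁ strict21 f W)
  = strict21 f (X ⊗ W) ∘ ((Y ◁ c X Z W) ∘ c X Y (Z ⊗ W)).
Proof.
have H := braid_nat (idm X) f; strict_hyp H W; rewrite [LHS]H.
congr (_ ∘ _); exact: (sbr_tensr (OAtom X) (OAtom Y) (OAtom Z)).
Qed.

Lemma braid_mull (f : Y ⊗ Z ~> V) W :
  c V X W ∘ strict21 f (X ⊗ W)
  = (X ◁ strict21 f W) ∘ (c Y X (Z ⊗ W) ∘ (Y ◁ c Z X W)).
Proof.
have H := braid_nat f (idm X); strict_hyp H W; rewrite [LHS]H.
congr (_ ∘ _); exact: (sbr_tensl (OAtom Y) (OAtom Z) (OAtom X)).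
Qed.

Lemma braid_comulr (f : V ~> Y ⊗ Z) W :
  (Y ◁ c X Z W) ∘ (c X Y (Z ⊗ W) ∘ (X ◁ strict12 f W))
  = strict12 f (X ⊗ W) ∘ c X V W.
Proof.
have H := braid_nat (idm X) f; strict_hyp H W; rewrite -[RHS]H compA.
congr (_ ∘ _); exact: esym (sbr_tensr (OAtom X) (OAtom Y) (OAtom Z) W).
Qed.

Lemma braid_comull (f : V ~> Y ⊗ Z) W :
  c Y X (Z ⊗ W) ∘ ((Y ◁ c Z X W) ∘ strict12 f (X ⊗ W))
  = (X ◁ strict12 f W) ∘ c V X W.
Proof.
have H := braid_nat f (idm X); strict_hyp H W; rewrite -[RHS]H compA.
congr (_ ∘ _); exact: esym (sbr_tensl (OAtom Y) (OAtom Z) (OAtom X) W).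
Qed.

Lemma braid_counr (f : V ~> munit) W :
  strict10 f (X ⊗ W) ∘ c X V W = X ◁ strict10 f W.
Proof.
have H := braid_nat (idm X) f; strict_hyp H W; rewrite -[LHS]H -[RHS]comp_idl.
congr (_ ∘ _); exact: (sbr_unitr (OAtom X)).
Qed.

Lemma braid_counl (f : V ~> munit) W :
  (X ◁ strict10 f W) ∘ c V X W = strict10 f (X ⊗ W).
Proof.
have H := braid_nat f (idm X); strict_hyp H W; rewrite -[LHS]H -[RHS]comp_idl.
congr (_ ∘ _); exact: (sbr_unitl (OAtom X)).
Qed.

Lemma braid_unitr (f : munit ~> V) W :
  c X V W ∘ (X ◁ strict01 f W) = strict01 f (X ⊗ W).
Proof.
have H := braid_nat (idm X) f; strict_hyp H W; rewrite [LHS]H -[RHS]comp_idr.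
congr (_ ∘ _); exact: (sbr_unitr (OAtom X)).
Qed.

Lemma braid_natl (f : V ~> Y) W :
  c Y X W ∘ strict11 f (X ⊗ W) = (X ◁ strict11 f W) ∘ c V X W.
Proof. by have H := braid_nat f (idm X); strict_hyp H W. Qed.

(** Naturality of the braiding with respect to a braiding, with a hexagon on each side. *)
Lemma yang_baxter W :
  (Z ◁ c X Y W) ∘ (c X Z (Y ⊗ W) ∘ (X ◁ c Y Z W))
  = c Y Z (X ⊗ W) ∘ ((Y ◁ c X Z W) ∘ c X Y (Z ⊗ W)).
Proof.
have H := braid_nat (idm X) (braid Y Z); strict_hyp H W.
have E a b d := sbr_tensr (OAtom a) (OAtom b) (OAtom d) W.
rewrite compA -[_ ∘ c X Z _](E X Z Y) [LHS]H; congr (_ ∘ _); exact: E.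
Qed.

Lemma strict_braidK W :
  strict22 (braidi X Y) W ∘ c X Y W = idm _.
Proof. exact: (sbrK (OAtom X) (OAtom Y)). Qed.

Lemma strict_braidiK W :
  c X Y W ∘ strict22 (braidi X Y) W = idm _.
Proof. exact: (sbriK (OAtom X) (OAtom Y)). Qed.

End BraidNaturality.

(** * The coopposite comultiplication *)

Section Coopposite.
Variables (M : braided_category) (B : M).
Variables (m : B ⊗ B ~> B) (e : munit ~> B) (d : B ~> B ⊗ B) (n : B ~> munit).

Notation sm := (strict21 m).
Notation se := (strict01 e).
Notation sd := (strict12 d).
Notation sn := (strict10 n).
Notation sc := (strict22 (braid B B)).
Notation sci := (strict22 (braidi B B)).
Notation cop := (braidi B B ∘ d).

Lemma strict_cop W : strict12 cop W = sci W ∘ sd W.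
Proof. exact: (@strict_comp M (OAtom B) (OTens (OAtom B) (OAtom B))
  (OTens (OAtom B) (OAtom B))). Qed.

Lemma scounitl_cop : scounitr d n -> scounitl cop n.
Proof.
move=> dur W; rewrite strict_cop compA -[RHS](dur W); congr (_ ∘ _).
exact: (@braid_counr (rev_braided M)).
Qed.

Lemma scounitr_cop : scounitl d n -> scounitr cop n.
Proof.
move=> dul W; rewrite strict_cop compA -[RHS](dul W); congr (_ ∘ _).
exact: (@braid_counl (rev_braided M)).
Qed.

Lemma scoassoc_cop : scoassoc d -> scoassoc cop.
Proof.
move=> dA W; rewrite !strict_cop ?chainE.
have := @braid_comulr (rev_braided M) B B B B d W => /= Hr.
have := @braid_comull (rev_braided M) B B B B d W => /= Hl.
have := @yang_baxter (rev_braided M) B B B W => /= yb.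
(* Once the comultiplications have slid through the crossings, coassociativity of [d] leaves two
   orders of three inverse crossings, related by Yang-Baxter. *)
rewrite (chain2 (esym Hr)) (chain2 (esym Hl)) ?chainE dA.
rewrite ?compA; congr (_ ∘ _ ∘ _); rewrite ?chainE.
exact: esym yb.
Qed.

(** Sliding the inverse crossing through both products yields four inverse crossings: one cancels
    the crossing in (b), two fall on the comultiplications and one stays in the middle. *)
Lemma sbimon_cop :
  sassoc m -> sbimon m d (braid B B) -> sbimon m cop (braidi B B).
Proof.
move=> mA b W; rewrite !strict_cop ?chainE b.
have Hr U := @braid_mulr (rev_braided M) B B B B m U; rewrite /= in Hr.
have Hl U := @braid_mull (rev_braided M) B B B B m U; rewrite /= in Hl.
rewrite (chain2 (Hl _)) ?chainE (chain2 (whl2 _ (Hr _))) ?chainE.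
rewrite (chain2 (whl2 _ (strict_braidK _ _ _))) ?chainE (chain2 (Hr _)) ?chainE.
rewrite (chain2 (nat12 _ d)) ?chainE (chain2 (nat22 _ (braidi B B))) ?chainE.
by rewrite (chain2 (nat21 _ m)) ?chainE.
Qed.

Definition sbimonad1 := forall W,
  sm W ∘ ((B ◁ sn (B ⊗ W)) ∘ ((B ◁ sm (B ⊗ W)) ∘ (sc (B ⊗ (B ⊗ W))
      ∘ ((B ◁ sd (B ⊗ W)) ∘ (B ◁ strict01 e (B ⊗ W))))))
  = (B ◁ sn W) ∘ ((B ◁ sm W) ∘ (sc (B ⊗ W) ∘ (B ◁ sd W))).

(** [(B ⊗ εμ)(c ⊗ B) = (εμ ⊗ B)(B ⊗ c^{-1})], and the comultiplication absorbs the inverse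
    crossing. *)
Lemma sbimonad1_cop : sbimonad1 <-> sbimonad2 m e cop n.
Proof.
have H W : (B ◁ sn W) ∘ ((B ◁ sm W) ∘ sc (B ⊗ W))
    = sn (B ⊗ W) ∘ (sm (B ⊗ W) ∘ (B ◁ sci W)).
  rewrite -(@braid_counr (rev_braided M) B B n W) /= ?chainE.
  rewrite (chain2 (@braid_mulr (rev_braided M) B B B B m W)) /= ?chainE.
  by rewrite strict_braidK comp_idr.
by split=> w W; move: (w W);
  rewrite (chain3 (H _)) (chain3 (H _)) !strict_cop ?chainE.
Qed.

Definition sbimonad3 := forall W,
  (B ◁ sm (B ⊗ W)) ∘ (sc (B ⊗ (B ⊗ W)) ∘ ((B ◁ sd (B ⊗ W))
      ∘ ((B ◁ se (B ⊗ W)) ∘ (sd W ∘ se W))))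
  = sd (B ⊗ W) ∘ (sd W ∘ se W).

Definition sbimonad4 := forall W,
  (B ◁ sm (B ⊗ W)) ∘ ((B ◁ (B ◁ sd W)) ∘ ((B ◁ (B ◁ se W)) ∘ (sd W ∘ se W)))
  = sd (B ⊗ W) ∘ (sd W ∘ se W).

Definition sweak_unit1 := forall W,
  sd (B ⊗ W) ∘ (sd W ∘ se W)
  = (B ◁ sm (B ⊗ W)) ∘ (sd (B ⊗ (B ⊗ W))
      ∘ ((B ◁ sd W) ∘ (se (B ⊗ W) ∘ se W))).

Definition sweak_unit2 := forall W,
  sd (B ⊗ W) ∘ (sd W ∘ se W)
  = (B ◁ sm (B ⊗ W)) ∘ ((B ◁ sci (B ⊗ W)) ∘ (sd (B ⊗ (B ⊗ W))
      ∘ ((B ◁ sd W) ∘ (se (B ⊗ W) ∘ se W)))).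

(** Naturality moves the nested copy of [δη] in (W4) beside the other one. *)
Lemma sweak_unit1P : sweak_unit1 <-> sbimonad4.
Proof.
have H W : (B ◁ (B ◁ sd W)) ∘ ((B ◁ (B ◁ se W)) ∘ (sd W ∘ se W))
    = sd (B ⊗ (B ⊗ W)) ∘ ((B ◁ sd W) ∘ (se (B ⊗ W) ∘ se W)).
  rewrite (chain2 (esym (nat12 _ d))) ?chainE -(nat01 _ e).
  by rewrite (chain2 (esym (nat12 _ d))) ?chainE.
by split=> w W; [rewrite H -w | rewrite -w H].
Qed.

(** A crossing with [η] is trivial, so the crossing in (W3) slides past [δη] and leaves an inverse
    crossing behind. *)
Lemma sweak_unit2P : sweak_unit2 <-> sbimonad3.
Proof.
have H W : sc (B ⊗ (B ⊗ W)) ∘ ((B ◁ sd (B ⊗ W))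
      ∘ ((B ◁ se (B ⊗ W)) ∘ (sd W ∘ se W)))
    = (B ◁ sci (B ⊗ W)) ∘ (sd (B ⊗ (B ⊗ W))
      ∘ ((B ◁ sd W) ∘ (se (B ⊗ W) ∘ se W))).
  rewrite -[LHS]comp_idl -(tensm_id B) -(strict_braidK B B) ?chainE.
  rewrite (chain3 (braid_comulr _ _ _)) ?chainE (chain2 (braid_unitr _ _ _)).
  by rewrite (chain2 (nat01 (sd W) e)) ?chainE.
by split=> w W; [rewrite H -w | rewrite -w H].
Qed.

End Coopposite.

(** * Weak bimonoids and weak bimonads *)

Section Equivalence.
Variables (M : braided_category) (B : monoid M).

Definition tau_of (d : B ~> B ⊗ B) (X Y : M) :
    (X ⊗ Y) ⊗ B ~> (X ⊗ B) ⊗ (Y ⊗ B) :=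
  mid X B (braid Y B) ∘ ((X ⊗ Y) ◁ d).

Definition tau0_of (n : B ~> munit) : munit ⊗ B ~> munit := n ∘ lunit B.

Lemma is_comonoidP (d : B ~> B ⊗ B) (n : B ~> munit) :
  is_comonoid d n <-> [/\ scoassoc d, scounitl d n & scounitr d n].
Proof.
split=> [[dA dul dur] | [dA dul dur]]; split.
- by move=> W; strict_hyp dA W.
- by move=> W; strict_hyp dul W.
- by move=> W; strict_hyp dur W.
- by strict_goal; apply: dA.
- by strict_goal; apply: dul.
- by strict_goal; apply: dur.
Qed.

(** Each of (W1) to (W5) is brought to its unit-object instance, tensored on the left with the
    objects and, where needed, composed with braidings. *)
Lemma bimonad_of_strict (d : B ~> B ⊗ B) (n : B ~> munit) :
  is_comonoid d n -> sbimon (mul B) d (braid B B) ->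
  sbimonad1 (mul B) (unt B) d n -> sbimonad2 (mul B) (unt B) d n ->
  sbimonad3 (mul B) (unt B) d -> sbimonad4 (mul B) (unt B) d ->
  {T : weak_bimonad (rtens_monad B) |
    (forall X Y, tau T X Y = tau_of d X Y) /\ tau0 T = tau0_of n}.
Proof.
move=> /is_comonoidP[dA dul dur] b w1 w2 w3 w4.
unshelve refine (exist _ (@WeakBimonad M (rtens_monad B)
  (tau_of d) (tau0_of n) _ _ _ _ _ _) _); [split|..|by split];
  intros; rewrite /= /rtens_mm /rtens_mu /tau_of /tau0_of /mid /rebr /rebri;
  strict_goal; rewrite ?sbr_tensl ?sbr_unitl ?chainE /= ?chainE.
- rewrite (chain2 (esym (nat11 _ f))) ?chainE (chain2 (esym (nat11 _ f))).
  rewrite ?chainE (whl2 _ (esym (nat11 _ g))) ?chainE.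
  by rewrite (chain2 (whl2 _ (braid_natl _ _ _))) ?chainE.
- rewrite (chain2 (whl2 _ (whl2 _ (esym (braid_comulr _ _ _))))) ?chainE.
  rewrite (whl2 _ (whl2 _ (whl2 _ (dA _)))) ?chainE.
  rewrite (chain2 (whl2 _ (esym (nat22 _ _)))) ?chainE.
  rewrite (chain2 (whl2 _ (esym (nat22 _ _)))) ?chainE.
  by rewrite (chain2 (whl2 _ (whl2 _ (esym (nat22 _ _))))) ?chainE.
- by rewrite (chain2 (braid_counr _ _ _)) -whl_comp dul tensm_id.
- by rewrite -whl_comp dur tensm_id.
- by have := congr1 (tensm (idm X)) (w1 W); rewrite !whl_comp.
(* (W2): [H] carries the counit across [X], at the price of an inverse braiding at the source. *)
- have H U : strict10 n (X ⊗ U) ∘ (strict21 (mul B) (X ⊗ U)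
        ∘ (B ◁ strict22 (braid X B) U))
      = (X ◁ strict10 n U) ∘ ((X ◁ strict21 (mul B) U)
        ∘ strict22 (braidi X B) (B ⊗ U)).
    rewrite -(braid_counr X n U) ?chainE (chain2 (braid_mulr _ _ _)) ?chainE.
    by rewrite strict_braidiK comp_idr.
  rewrite !(chain3 (H _)) ?chainE !(chain2 (nat22 _ _)) ?chainE !nat22.
  have := congr1 (fun f => (X ◁ f) ∘ strict22 (braidi X B) (B ⊗ W)) (w2 W).
  by rewrite ?chainE.
- rewrite (chain2 (whl2 _ (esym (nat22 _ _)))) ?chainE.
  (* (W3): the unit is created to the right of [Z] and braided across it, so that the [Z] strand can
     leave the equation. *)
  rewrite -(braid_unitr Z (unt B) (B ⊗ W)) ?chainE.
  rewrite (chain2 (whl2 _ (whl2 _ (esym (nat22 _ _))))) ?chainE.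
  rewrite (chain2 (whl2 _ (whl2 _ (whl2 _ (esym (braid_comulr _ _ _)))))).
  rewrite ?chainE.
  rewrite (chain2 (whl2 _ (whl2 _ (esym (nat22 _ _))))) ?chainE.
  rewrite (chain2 (whl2 _ (whl2 _ (nat22 _ (braid B B))))) ?chainE.
  rewrite (chain3 (whl3 _ (whl3 _ (esym (yang_baxter _ _ _ _))))) ?chainE.
  rewrite (chain3 (whl3 _ (whl3 _ (whl3 _ (esym (braid_mulr _ _ _)))))) ?chainE.
  rewrite (chain2 (whl2 _ (whl2 _ (esym (nat22 _ _))))) ?chainE.
  rewrite (chain2 (whl2 _ (whl2 _ (esym (braid_comulr _ _ _))))) ?chainE.
  (* Context of the unit instance: the [Z] strand crosses two copies of [B], then the [Y] strand
     crosses the first. *)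
  have := congr1 (fun f => X ◁ (strict22 (braid Y B) _ ∘ (Y ◁
    ((B ◁ strict22 (braid Z B) _) ∘ (strict22 (braid Z B) _ ∘ (Z ◁ f))))))
    (w3 W).
  by rewrite ?chainE.
- do 3!rewrite (chain2 (whl2 _ (esym (nat22 _ _)))) ?chainE.
  rewrite (chain2 (whl2 _ (esym (nat22 _ _)))) ?chainE.
  rewrite -(braid_unitr Z (unt B) W) ?chainE.
  rewrite !(chain2 (whl2 _ (whl2 _ (esym (braid_comulr _ _ _))))) ?chainE.
  do 2!rewrite (chain2 (whl2 _ (whl2 _ (whl2 _ (esym (nat22 _ _)))))) ?chainE.
  do 2!rewrite (chain2 (whl2 _ (whl2 _ (esym (nat22 _ _))))) ?chainE.
  rewrite (chain3 (whl3 _ (whl3 _ (whl3 _ (esym (braid_mulr _ _ _)))))) ?chainE.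
  rewrite (chain2 (whl2 _ (whl2 _ (esym (nat22 _ _))))) ?chainE.
  have := congr1 (fun f => X ◁ (strict22 (braid Y B) _ ∘ (Y ◁
    ((B ◁ strict22 (braid Z B) _) ∘ (strict22 (braid Z B) _ ∘ (Z ◁ f))))))
    (w4 W).
  by rewrite ?chainE.
(* (W5), where only the [Y] strand has a crossing to collect. *)
- do 2!rewrite (chain2 (whl2 _ (esym (nat22 _ _)))) ?chainE.
  rewrite (chain2 (whl2 _ (whl2 _ (esym (nat22 _ _))))) ?chainE.
  rewrite (chain2 (whl2 _ (esym (nat22 _ _)))) ?chainE.
  rewrite (whl2 _ (whl2 _ (esym (nat12 _ _)))) ?chainE.
  rewrite (chain3 (whl3 _ (esym (braid_mulr _ _ _)))) ?chainE.
  have := congr1 (fun f => X ◁ (strict22 (braid Y B) _ ∘ (Y ◁ f))) (b W).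
  by rewrite ?chainE => ->.
Qed.

(** All objects are specialised to the unit, whose crossings vanish by [sbr_unitl]. *)
Lemma strict_of_bimonad (T : weak_bimonad (rtens_monad B))
    (d : B ~> B ⊗ B) (n : B ~> munit) :
  (forall X Y, tau T X Y = tau_of d X Y) -> tau0 T = tau0_of n ->
  [/\ is_comonoid d n, sbimon (mul B) d (braid B B),
      sbimonad1 (mul B) (unt B) d n, sbimonad2 (mul B) (unt B) d n
    & sbimonad3 (mul B) (unt B) d /\ sbimonad4 (mul B) (unt B) d].
Proof.
move=> tE t0E; have [_ dA dul dur] := wbd_opmonoidal T.
move: (dA munit munit munit) (dul munit) (dur munit) (wbd_1 T munit)
  (wbd_2 T munit) (wbd_3 T munit munit munit) (wbd_4 T munit munit munit)
  (wbd_5 T munit munit) => {}dA {}dul {}dur w1 w2 w3 w4 b.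
rewrite ?t0E ?tE /= /rtens_mm /rtens_mu /tau_of /tau0_of /mid /rebr /rebri
  in dA dul dur w1 w2 w3 w4 b.
split; last split; first (apply/is_comonoidP; split); move=> W.
- by strict_hyp dA W; rewrite ?sbr_tensl !sbr_unitl ?chainE /= ?chainE in dA.
- by strict_hyp dul W; rewrite sbr_unitl ?chainE /= ?chainE in dul.
- by strict_hyp dur W; rewrite sbr_unitl ?chainE /= ?chainE in dur.
- by strict_hyp b W; rewrite ?sbr_tensl !sbr_unitl ?chainE /= ?chainE in b;
  rewrite -b nat12.
- by strict_hyp w1 W; rewrite ?sbr_tensl !sbr_unitl ?chainE /= ?chainE in w1.
- by strict_hyp w2 W; rewrite ?sbr_tensl !sbr_unitl ?chainE /= ?chainE in w2.
- by strict_hyp w3 W; rewrite ?sbr_tensl !sbr_unitl ?chainE /= ?chainE in w3.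
- by strict_hyp w4 W; rewrite ?sbr_tensl !sbr_unitl ?chainE /= ?chainE in w4.
Qed.

Lemma sassoc_mul : sassoc (mul B).
Proof. by move=> W; have H := mulA B; strict_hyp H W. Qed.

Lemma sunitl_mul : sunitl (mul B) (unt B).
Proof. by move=> W; have H := mul_untl B; strict_hyp H W. Qed.

Lemma bimonad_of_bimonoid (S : weak_bimonoid B) :
  {T : weak_bimonad (rtens_monad B) |
    (forall X Y, tau T X Y = tau_of (comul S) X Y)
    /\ tau0 T = tau0_of (coun S)}.
Proof.
case: S => d n C b v1 v2 w1 w2 /=.
have [dA dul dur] := proj1 (is_comonoidP d n) C.
rewrite /mid /rebr /rebri in b v1 v2 w1 w2.
have sb : sbimon (mul B) d (braid B B) by move=> W; strict_hyp b W.
apply: bimonad_of_strict => //.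
(* (W1) is (W2) for the coopposite comultiplication; the second half of (v) supplies its counit
   axiom. *)
- apply/sbimonad1_cop/(sbimonad2_of_weak_counit sassoc_mul sunitl_mul).
  + exact: scoassoc_cop.
  + exact: scounitl_cop.
  + exact: sbimon_cop sassoc_mul sb.
  + by move=> W; strict_hyp v2 W; rewrite strict_cop ?chainE.
- apply: (sbimonad2_of_weak_counit sassoc_mul sunitl_mul dA dul sb) => W.
  by strict_hyp v1 W.
- by apply/sweak_unit2P => W; strict_hyp w2 W.
- by apply/sweak_unit1P => W; strict_hyp w1 W.
Qed.

Lemma bimonoid_of_bimonad (T : weak_bimonad (rtens_monad B))
    (d : B ~> B ⊗ B) (n : B ~> munit) :
  (forall X Y, tau T X Y = tau_of d X Y) -> tau0 T = tau0_of n ->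
  {S : weak_bimonoid B | comul S = d /\ coun S = n}.
Proof.
move=> tE t0E; have [C b w1 w2 [w3 w4]] := strict_of_bimonad tE t0E.
have [dA dul dur] := proj1 (is_comonoidP d n) C.
have mA := sassoc_mul.
have v1 := weak_counit_of_sbimonad2 mA dur w2.
have v2 := weak_counit_of_sbimonad2 mA (scounitr_cop dul)
  (proj1 (sbimonad1_cop _ _ _ _) w1).
have {}w3 := proj2 (sweak_unit2P _ _ _) w3.
have {}w4 := proj2 (sweak_unit1P _ _ _) w4.
unshelve refine (exist _ (@WeakBimonoid M B d n C _ _ _ _ _) _); last by [];
  rewrite /mid /rebr /rebri; strict_goal.
- exact: b.
- exact: v1.
- by have := v2 W; rewrite strict_cop ?chainE.
- exact: w4.
- exact: w3.
Qed.

(** The crossing in [τ_{K,K}] is with the unit, hence trivial. *)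
Lemma tauKK_tau_of (T : weak_bimonad (rtens_monad B)) (d : B ~> B ⊗ B) :
  (forall X Y, tau T X Y = tau_of d X Y) -> tauKK T = d.
Proof.
move=> tE; rewrite /tauKK tE /tau_of /mid /rebr /rebri; strict_goal.
by rewrite sbr_unitl ?chainE.
Qed.

Lemma weak_bimonoid_eq (S S' : weak_bimonoid B) :
  comul S = comul S' -> coun S = coun S' -> S = S'.
Proof.
case: S S' => [d n ? ? ? ? ? ?] [d' n' ? ? ? ? ? ?] /= ed en; subst d' n'.
by f_equal; apply: proof_irrelevance.
Qed.

Lemma weak_bimonad_eq (T T' : weak_bimonad (rtens_monad B)) :
  (forall X Y, tau T X Y = tau T' X Y) -> tau0 T = tau0 T' -> T = T'.
Proof.
case: T T' => [t n ? ? ? ? ? ?] [t' n' ? ? ? ? ? ?] /= et en; subst n'.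
have e : t = t'.
  by do 2!apply: functional_extensionality_dep => ?; apply: et.
by subst t'; f_equal; apply: proof_irrelevance.
Qed.

End Equivalence.

Theorem theorem3p1 (M : braided_category) (M_cauchy : cauchy_complete M)
    (B : monoid M) :
  exists f : weak_bimonoid B ->
             {S : weak_bimonad (rtens_monad B) | tau_from_tauKK S},
    bijective f.
Proof.
have tau_from (S : weak_bimonoid B) (T := bimonad_of_bimonoid S) :
    tau_from_tauKK (sval T).
  by case: T => T [tE t0E] /= X Y; rewrite (tauKK_tau_of tE) tE.
(* [ε] is read off from [τ0] along [B ≅ K ⊗ B]. *)
have t0E (T : weak_bimonad (rtens_monad B)) :
  tau0 T = tau0_of (tau0 T ∘ luniti B).
  by rewrite /tau0_of -compA lunitK comp_idr.
exists (fun S => exist _ (sval (bimonad_of_bimonoid S)) (tau_from S)).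
exists (fun T => sval (bimonoid_of_bimonad (svalP T) (t0E (sval T)))).
- move=> S; case: (bimonoid_of_bimonad _ _) => S' /= [].
  case: (bimonad_of_bimonoid S) => T [tE tE0] /=; rewrite (tauKK_tau_of tE) tE0.
  rewrite /tau0_of -compA lunitiK comp_idr.
  exact: weak_bimonoid_eq.
- case=> T tK; case: (bimonoid_of_bimonad _ _) => S /= [dE nE].
  (* The side condition is a proposition, so only the bimonads need comparing. *)
  apply: eq_exist_uncurried; unshelve eexists; last exact: proof_irrelevance.
  case: (bimonad_of_bimonoid S) => T' [tE tE0] /=; apply: weak_bimonad_eq.
    by move=> X Y; rewrite tE dE tK.
  by rewrite tE0 nE -t0E.
Qed.
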